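(* Let $k\geq 2$ and $n\geq 0$. Then \[ \mathcal{O}_{1,k}(n)=\bigcup_{\lambda\in\mathcal{O}_k(n)}\ \bigcup_{i}\mathcal{O}_{\lambda,k,i}, \] where the inner union runs over the distinct parts $i$ of $\lambda$, and the sets $\mathcal{O}_{\lambda,k,i}$ (for the different pairs $(\lambda,i)$) are pairwise disjoint.
   Context: A partition of $n$ is a finite nonincreasing sequence of positive integers summing to $n$. $\mathcal{O}_k(n)$ is the set of partitions of $n$ with no part divisible by $k$; $\mathcal{O}_{1,k}(n)$ is the set of partitions of $n$ having exactly one distinct part value divisible by $k$ (possibly repeated), all other parts being not divisible by $k$. For a positive integer $m$ with base-$k$ expansion $m=b_1k^{a_1}+\cdots+b_pk^{a_p}$ ($a_1>\cdots>a_p\geq 0$, $1\leq b_j\leq k-1$), let $a(m)=a_1$. For $\lambda\in\mathcal{O}_k(n)$ and a part $i$ of $\lambda$ of multiplicity $m_i$, for integers $1\leq j\leq a(m_i)$ and $1\leq r\leq\lfloor m_i/k^j\rfloor$ let $\pi^i_{j,r}$ be the partition obtained from $\lambda$ by replacing $r\cdot k^j$ of the parts equal to $i$ by $r$ parts equal to $i\cdot k^j$. Define $\mathcal{O}_{\lambda,k,i}=\{\pi^i_{j,r}:1\leq j\leq a(m_i),\ 1\leq r\leq\lfloor m_i/k^j\rfloor\}$ (empty if $m_i<k$). *)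

(* Defs.v *)
From mathcomp Require Import all_boot.
From mathcomp Require Import classical_sets.

Set Implicit Arguments.
Unset Strict Implicit.
Unset Printing Implicit Defensive.

Local Open Scope classical_set_scope.

Definition is_partition (n : nat) (l : seq nat) : bool :=
  [&& sorted geq l, all (leq 1) l & sumn l == n].

Definition O_k (k n : nat) : set (seq nat) :=
  [set l | is_partition n l && all (fun x => ~~ (k %| x)) l].

(* [undup] makes [count] count part values rather than parts. *)
Definition O_1k (k n : nat) : set (seq nat) :=
  [set l | is_partition n l && (count (dvdn k) (undup l) == 1)].

(* [e] lists the pairs (b_j, a_j) of m = b_1 k^a_1 + ... + b_p k^a_p. *)
Definition base_expansion (k m : nat) (e : seq (nat * nat)) : bool :=
  [&& sorted gtn (unzip2 e), all (fun t => 1 <= t.1 <= k - 1) e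
    & m == \sum_(t <- e) t.1 * k ^ t.2].

(* The exponent a_1 of the base-k expansion; the default 0 is only reached when
   there is none with a leading term, i.e. for m = 0 (given 1 < k). *)
Definition lead_exp (k m : nat) : nat :=
  xget 0 [set a | exists b e, base_expansion k m ((b, a) :: e)].

(* Each iteration of [rem i] deletes one part equal to i. *)
Definition merge_parts (k : nat) (l : seq nat) (i j r : nat) : seq nat :=
  sort geq (nseq r (i * k ^ j) ++ iter (r * k ^ j) (rem i) l).

Definition O_part (k : nat) (l : seq nat) (i : nat) : set (seq nat) :=
  let m := count_mem i l in
  [set p | exists j r, [/\ 1 <= j <= lead_exp k m, 1 <= r <= m %/ k ^ j
                         & p = merge_parts k l i j r]].

(* Main.v *)
(* Every positive d is i * k ^ j for a unique j and a unique i not divisible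
   by k. If d is the only part value of p divisible by k, with multiplicity r,
   then p arises from merging r * k ^ j parts i, and only so: splitting each
   copy of d into k ^ j parts i recovers the original partition. *)
Require Import Defs.
From mathcomp Require Import all_boot.
From mathcomp Require Import classical_sets.

Local Open Scope classical_set_scope.

(** Induction from the leading term [b * k ^ c]: the tail stays below [k ^ c], so the sum is below
    [(b + 1) * k ^ c <= k ^ c.+1 <= k ^ a]. *)
Lemma base_expansion_lt k m e a : 0 < k -> base_expansion k m e ->
  all (fun t => t.2 < a) e -> m < k ^ a.
Proof.
move=> k0 /and3P[+ + /eqP->] {m}; elim: e a => [|[b c] e IHe] a /=.
  by rewrite big_nil expn_gt0 k0.
rewrite big_cons /= => be /andP[/andP[_ lebk] alle] /andP[ltca _].
have lte : \sum_(t <- e) t.1 * k ^ t.2 < k ^ c.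
  apply: IHe => //; first exact: path_sorted be.
  have gtn_trans : transitive gtn by move=> x y z /= ? /ltn_trans; apply.
  by have := order_path_min gtn_trans be; rewrite all_map.
apply: leq_trans (leq_pexp2l k0 ltca).
rewrite -addnS (leq_trans (leq_add (leqnn _) lte)) // -mulSnr expnS.
by rewrite leq_mul2r -[k in _ < k](subnK k0) addn1 ltnS lebk orbT.
Qed.

(** Induction on [a]: the quotient by [k ^ a] is the next digit, and the remainder is expanded
    recursively. A zero digit must be omitted, hence the case split on [m < k ^ a]. The bound on the
    exponents keeps the list strictly decreasing when a term is put in front. *)
Lemma base_expansion_exists k m a : 1 < k -> m < k ^ a ->
  exists2 e, base_expansion k m e & all (fun t => t.2 < a) e.
Proof.
move=> k1; have k0 := ltnW k1; elim: a m => [|a IHa] m.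
  by rewrite expn0 ltnS leqn0 => /eqP->; exists [::]; rewrite //
    /base_expansion /= big_nil.
move=> ltm; have ka0 : 0 < k ^ a by rewrite expn_gt0 k0.
have [lt_m_ka|le_ka_m] := ltnP m (k ^ a).
  have [e ? alle] := IHa _ lt_m_ka; exists e => //.
  by apply: sub_all alle => t /ltnW.
have [e /and3P[se be /eqP sum_e] alle] := IHa (m %% k ^ a) (ltn_pmod m ka0).
exists ((m %/ k ^ a, a) :: e); last first.
  by rewrite /= ltnSn; apply: sub_all alle => t /ltnW.
apply/and3P; split => /=.
- by rewrite path_min_sorted // all_map.
- rewrite be andbT divn_gt0 // le_ka_m /= -ltnS subn1 prednK //.
  by rewrite ltn_divLR // -expnS.
- by rewrite big_cons /= -sum_e -divn_eq.
Qed.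

(** Whichever expansion [xget] selects, its leading exponent [a] satisfies [m < k ^ a.+1], so
    [k ^ j <= m] forces [j <= a]. *)
Lemma lead_exp_ge k m j : 1 < k -> k ^ j <= m -> j <= lead_exp k m.
Proof.
move=> k1 lejm; have k0 := ltnW k1.
have m0 : 0 < m by rewrite (leq_trans _ lejm) // expn_gt0 k0.
rewrite /lead_exp; case: xgetP => [a Ea [b [e He]]|none].
  rewrite -ltnS -(ltn_exp2l _ _ k1); apply: leq_ltn_trans lejm _.
  apply: (base_expansion_lt k m _ a.+1 k0 He); rewrite /= ltnSn /=.
  have /and3P[/= be _ _] := He.
  have gtn_trans : transitive gtn by move=> x y z /= ? /ltn_trans; apply.
  have := order_path_min gtn_trans be; rewrite all_map.
  by apply: sub_all => t /ltnW.
(* The default of [xget] is excluded: [m] has an expansion, nonempty because [m > 0]. The exponent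
   bound is [m] itself, as [m < k ^ m]. *)
have [[|[b a] e] He _] := base_expansion_exists k m m k1 (ltn_expl m k1).
  by move: He m0; rewrite /base_expansion /= big_nil => /eqP->.
by case: (none a); exists b, e.
Qed.

Lemma expn_factor k d : 1 < k -> 0 < d ->
  exists i j, ~~ (k %| i) /\ d = i * k ^ j.
Proof.
move=> k1; elim/ltn_ind: d => d IHd d0.
have [/dvdnP[q Eq]|ndiv] := boolP (k %| d); last first.
  by exists d, 0; rewrite expn0 muln1.
have q0 : 0 < q by move: d0; rewrite Eq muln_gt0 => /andP[].
have [|i [j [ndiv Eqi]]] := IHd q _ q0; first by rewrite Eq ltn_Pmulr.
by exists i, j.+1; rewrite Eq Eqi expnSr mulnA.
Qed.

(** Cancel common factors [k] until one exponent is 0; the other must then be 0 too, or [k] would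
    divide [i] or [i']. *)
Lemma expn_factor_inj k i j i' j' : 1 < k -> ~~ (k %| i) -> ~~ (k %| i') ->
  i * k ^ j = i' * k ^ j' -> i = i' /\ j = j'.
Proof.
move=> k1 ndi ndi'; have k0 := ltnW k1.
elim: j j' => [|j IHj] [|j']; rewrite ?expn0 ?muln1 //.
- by move=> Ei; case/negP: ndi; rewrite Ei expnSr mulnA dvdn_mull.
- by move=> Ei; case/negP: ndi'; rewrite -Ei expnSr mulnA dvdn_mull.
rewrite !expnSr !mulnA => /eqP; rewrite eqn_pmul2r // => /eqP /IHj[-> ->].
by split.
Qed.

Lemma count_undup_eq1P (T : eqType) (a : pred T) (s : seq T) :
  reflect (exists d, forall x, (x \in s) && a x = (x == d))
          (count a (undup s) == 1).
Proof.
have memE x : (x \in filter a (undup s)) = (x \in s) && a x.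
  by rewrite mem_filter mem_undup andbC.
have uf : uniq (filter a (undup s)) by rewrite filter_uniq ?undup_uniq.
rewrite -size_filter; apply: (iffP idP) => [|[d Ed]].
  case: (filter a _) memE => [|d [|? ?]] // memE _.
  by exists d => x; rewrite -memE inE.
have /perm_size-> // : perm_eq (filter a (undup s)) [:: d].
by apply: uniq_perm => // x; rewrite memE Ed inE.
Qed.

Lemma perm_iter_rem (T : eqType) (x : T) (s : seq T) m :
  m <= count_mem x s -> perm_eq (nseq m x ++ iter m (rem x) s) s.
Proof.
elim: m s => [|m IHm] s // lt_m; rewrite iterSr /=.
have xs : x \in s by rewrite -has_pred1 has_count (leq_trans _ lt_m).
have Es := perm_to_rem xs.
rewrite perm_sym (perm_trans Es) // perm_cons perm_sym IHm //.
by move/permP/(_ (pred1 x)): Es lt_m => -> /=; rewrite eqxx.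
Qed.

(** Reduces equality of partitions to equality of multisets of parts. *)
Lemma geq_sorted_eq s t : sorted geq s -> sorted geq t -> perm_eq s t -> s = t.
Proof.
apply: sorted_eq => [y x z /= xy yz|x y /= xy]; first exact: leq_trans yz xy.
by apply/eqP; rewrite eqn_leq andbC.
Qed.

Lemma sort_geq_sorted s : sorted geq (sort geq s).
Proof. by apply: sort_sorted => x y /=; exact: leq_total. Qed.

(** A removal-free description of merging: with the consumed parts added back on the left, later
    arguments can cancel, count or sum both sides. *)
Lemma perm_merge_parts k l i j r : r * k ^ j <= count_mem i l ->
  perm_eq (nseq (r * k ^ j) i ++ merge_parts k l i j r)
          (nseq r (i * k ^ j) ++ l).
Proof.
move=> le_m; rewrite /merge_parts.
apply: (@perm_trans _ (nseq (r * k ^ j) i ++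
    (nseq r (i * k ^ j) ++ iter (r * k ^ j) (rem i) l))).
  by rewrite perm_cat2l perm_sort.
by rewrite perm_catCA perm_cat2l perm_iter_rem.
Qed.

Lemma mem_geq1 n l x : is_partition n l -> x \in l -> 0 < x.
Proof. by case/and3P=> _ /allP pos _ /pos. Qed.

Lemma O_part_inv {k n l i p} : 1 < k -> O_k k n l -> i \in l -> O_part k l i p ->
  exists j r, [/\ ~~ (k %| i), 0 < j, 0 < r,
    perm_eq (nseq (r * k ^ j) i ++ p) (nseq r (i * k ^ j) ++ l)
    & sorted geq p].
Proof.
move=> k1 /andP[_ /allP nd] il [j [r [/andP[j0 _] /andP[r0 ler] ->]]].
exists j, r; split=> //; [exact: nd| |exact: sort_geq_sorted].
apply: perm_merge_parts.
by rewrite -leq_divRL // expn_gt0 (ltnW k1).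
Qed.

(** Neither [l] nor the copies of [i] contribute multiples of [k], so only the [r] merged parts
    remain. For [0 < r] and [0 < j], [p] thus determines both [i * k ^ j] and [r]. *)
Lemma count_merged k l i j r p : all (fun x => ~~ (k %| x)) l ->
  perm_eq (nseq (r * k ^ j) i ++ p) (nseq r (i * k ^ j) ++ l) ->
  ~~ (k %| i) -> forall x, k %| x ->
  count_mem x p = if x == i * k ^ j then r else 0.
Proof.
move=> /allP nd /permP Ep ndi x kx; have := Ep (pred1 x).
rewrite !count_cat !count_nseq /=.
have -> : count_mem x l = 0.
  apply/eqP; rewrite -leqn0 leqNgt -has_count has_pred1.
  by apply/negP => /nd; rewrite kx.
have -> : (i == x) = false by apply: contraNF ndi => /eqP->.
by rewrite mul0n add0n addn0 eq_sym => ->; case: eqP => _; rewrite ?mul1n ?mul0n.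
Qed.

Lemma O_part_sub_O_1k k n l i : 1 < k -> O_k k n l -> i \in l ->
  O_part k l i `<=` O_1k k n.
Proof.
move=> k1 Ol il p Op.
have [j [r [ndi j0 r0 Ep sp]]] := O_part_inv k1 Ol il Op.
move/andP: (Ol) => [pl ndl]; have /and3P[_ _ /eqP sl] := pl.
have i0 : 0 < i := mem_geq1 n l i pl il.
have kj0 : 0 < k ^ j by rewrite expn_gt0 (ltnW k1).
have kd : k %| i * k ^ j by rewrite dvdn_mull // dvdn_exp.
apply/andP; split.
  rewrite /is_partition sp /=; apply/andP; split.
    apply/allP => x xp.
    have : x \in nseq r (i * k ^ j) ++ l.
      by rewrite -(perm_mem Ep) mem_cat xp orbT.
    rewrite mem_cat => /orP[|/(mem_geq1 n l x pl)//].
    by rewrite mem_nseq => /andP[_ /eqP->]; rewrite muln_gt0 i0.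
  (* The total is preserved: [r * k ^ j] parts [i] and [r] parts [i * k ^ j] have the same sum. *)
  have := perm_sumn Ep; rewrite !sumn_cat !sumn_nseq sl.
  by rewrite (mulnC r) mulnA => /eqP; rewrite eqn_add2l.
apply/count_undup_eq1P; exists (i * k ^ j) => x.
have [kx|nkx] := boolP (k %| x); last first.
  by rewrite andbF; apply/esym; apply: contraNF nkx => /eqP->.
rewrite andbT -has_pred1 has_count.
by rewrite (count_merged k l i j r p ndl Ep ndi x kx); case: eqP.
Qed.

Lemma O_1k_merged k n p : 1 < k -> O_1k k n p ->
  exists l i, [/\ O_k k n l, i \in l & O_part k l i p].
Proof.
move=> k1 /andP[/and3P[sp pos /eqP sum_p] /count_undup_eq1P[d Ed]].
have /andP[dp kd] : (d \in p) && (k %| d) by rewrite Ed.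
have d0 : 0 < d by move/allP: pos => /(_ d dp).
have [i [j [ndi Edi]]] := expn_factor k d k1 d0.
have kj0 : 0 < k ^ j by rewrite expn_gt0 (ltnW k1).
have i0 : 0 < i by move: d0; rewrite Edi muln_gt0 => /andP[].
have j0 : 0 < j.
  by case: j Edi {kj0} => // Edi; move: kd; rewrite Edi muln1 (negbTE ndi).
pose r := count_mem d p.
have r0 : 0 < r by rewrite /r -has_count has_pred1.
pose q := [seq x <- p | x != d].
pose l := sort geq (nseq (r * k ^ j) i ++ q).
have Pl : perm_eq l (nseq (r * k ^ j) i ++ q) by rewrite perm_sort.
have Pp : perm_eq (nseq r d ++ q) p.
  apply: perm_trans (permEl (perm_filterC (pred1 d) p)).
  rewrite /r /q perm_cat2r.
  by have /all_pred1P := filter_all (pred1 d) p; rewrite size_filter => ->.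
have mem_l x : x \in l -> x = i \/ x \in p /\ x <> d.
  rewrite (perm_mem Pl) mem_cat mem_nseq mem_filter.
  by case/orP=> [/andP[_ /eqP]|/andP[/eqP ? ?]]; [left|right].
have il : i \in l by rewrite (perm_mem Pl) mem_cat mem_nseq eqxx muln_gt0 r0 kj0.
(* Only an inequality, since [p] may itself contain parts [i]. *)
have le_l : r * k ^ j <= count_mem i l.
  by rewrite (permP Pl) count_cat count_nseq /= eqxx mul1n leq_addr.
exists l, i; split=> //.
  apply/andP; split; [apply/and3P; split|].
  - exact: sort_geq_sorted.
  - by apply/allP => x /mem_l[->//|[xp _]]; move/allP: pos => ->.
  - rewrite (perm_sumn Pl) -sum_p -(perm_sumn Pp) !sumn_cat !sumn_nseq Edi.
    by rewrite (mulnC r) mulnA.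
  - apply/allP => x /mem_l[->//|[xp xd]]; apply/negP => kx.
    by apply: xd; apply/eqP; rewrite -Ed xp.
exists j, r; split.
- rewrite j0 lead_exp_ge // (leq_trans _ le_l) // leq_pmull //.
- by rewrite r0 leq_divRL.
apply: geq_sorted_eq => //; first exact: sort_geq_sorted.
(* Prefixing the merged copies of [i] brings the goal into the form of [perm_merge_parts]. *)
rewrite -(perm_cat2l (nseq (r * k ^ j) i)) perm_sym.
apply: perm_trans (perm_merge_parts k l i j r le_l) _.
rewrite -Edi; apply: (@perm_trans _ (nseq r d ++ (nseq (r * k ^ j) i ++ q))).
  by rewrite perm_cat2l.
by rewrite perm_catCA perm_cat2l.
Qed.

Lemma O_part_inj k n l i l' i' p : 1 < k ->
  O_k k n l -> i \in l -> O_part k l i p ->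
  O_k k n l' -> i' \in l' -> O_part k l' i' p -> (l, i) = (l', i').
Proof.
move=> k1 Ol il Op Ol' il' Op'.
have [j [r [ndi j0 r0 Ep _]]] := O_part_inv k1 Ol il Op.
have [j' [r' [ndi' j0' r0' Ep' _]]] := O_part_inv k1 Ol' il' Op'.
move/andP: Ol => [/and3P[sl _ _] ndl]; move/andP: Ol' => [/and3P[sl' _ _] ndl'].
have kd : k %| i * k ^ j by rewrite dvdn_mull // dvdn_exp.
(* The multiplicity of [i * k ^ j] in [p] is computed from both merges. The first gives [r > 0]; the
   second gives 0 unless [i * k ^ j = i' * k ^ j'], and then [r']. *)
have := count_merged k l i j r p ndl Ep ndi _ kd.
rewrite eqxx (count_merged k l' i' j' r' p ndl' Ep' ndi' _ kd).
case: eqP => [Ed|_ r_eq0]; last by rewrite -r_eq0 in r0.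
have [Ei Ej] := expn_factor_inj k i j i' j' k1 ndi ndi' Ed.
move=> Er; subst i' j' r'; congr (_, _).
apply: geq_sorted_eq => //.
(* With all parameters equal, [l] and [l'] extended by the same parts are permutations of one
   sequence, so the extension cancels. *)
rewrite -(perm_cat2l (nseq r (i * k ^ j))).
by apply: perm_trans Ep'; rewrite perm_sym.
Qed.

Theorem theorem3p3 (k n : nat) (hk : 2 <= k) :
  O_1k k n = \bigcup_(l in O_k k n) \bigcup_(i in [set i | i \in l]) O_part k l i
  /\ trivIset [set t : seq nat * nat | O_k k n t.1 /\ t.2 \in t.1]
              (fun t => O_part k t.1 t.2).
Proof.
split.
  apply/seteqP; split=> [p /(O_1k_merged k n p hk)[l [i [Ol il Op]]]|p].
    by exists l => //; exists i.
  by case=> l Ol [i il]; apply: (O_part_sub_O_1k k n l i).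
move=> [l i] [l' i'] [/= Ol il] [/= Ol' il'] [p [Op Op']].
exact: O_part_inj hk Ol il Op Ol' il' Op'.
Qed.
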